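(* Any half-extended Besicovitch set $K\subseteq\mathbb{R}^d$ has full Assouad dimension, i.e. $\dim_{\rm A}(K)=d$.
   Context: A set $K\subseteq\mathbb{R}^d$ is a half-extended Besicovitch set if for all $\theta\in S^{d-1}$ (the unit sphere of $\mathbb{R}^d$) there exists $t_\theta\in\mathbb{R}^d$ such that $\{\lambda\theta+t_\theta:\lambda\in[0,\infty)\}\subseteq K$. For $A\subseteq\mathbb{R}^d$ the Assouad dimension is \[ \dim_{\rm A}(A)=\inf\{s\ge0:\ \exists\, C>0\text{ such that } N(B(x,\delta)\cap A,\epsilon)\le C(\delta/\epsilon)^s\text{ for every }x\in A,\ 0<\epsilon<\delta\}, \] where $B(x,\delta)$ is the ball with centre $x$ and radius $\delta$, and $N(E,\epsilon)$ is the minimum number of balls of radius $\epsilon$ required to cover $E$. *)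

(* Defs.v *)
From mathcomp Require Import all_boot all_order all_algebra.
From mathcomp Require Import all_classical all_reals all_analysis.

Set Implicit Arguments.
Unset Strict Implicit.
Unset Printing Implicit Defensive.

Import Order.TTheory GRing.Theory Num.Theory.
Local Open Scope classical_set_scope.
Local Open Scope ring_scope.

(* R^d is 'rV[R]_d. The norm `|x| that the library puts on matrices is the sup
   norm, so the Euclidean norm, sphere and balls are defined here. *)
Definition enorm (R : realType) (d : nat) (x : 'rV[R]_d) : R :=
  Num.sqrt (\sum_(i < d) x ord0 i ^+ 2).

Definition unit_sphere (R : realType) (d : nat) : set 'rV[R]_d :=
  [set theta | enorm theta = 1].

Definition eball (R : realType) (d : nat) (x : 'rV[R]_d) (r : R) :
    set 'rV[R]_d :=
  [set y | enorm (y - x) <= r].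

Definition half_extended_besicovitch (R : realType) (d : nat)
    (K : set 'rV[R]_d) : Prop :=
  forall theta, unit_sphere theta -> exists t : 'rV[R]_d,
    [set lambda *: theta + t | lambda in [set l : R | 0 <= l]] `<=` K.

(* The centres of the covering balls need not lie in E. *)
Definition covered_by (R : realType) (d : nat) (E : set 'rV[R]_d) (eps : R)
    (n : nat) : Prop :=
  exists c : 'I_n -> 'rV[R]_d, E `<=` \bigcup_(i in [set: 'I_n]) eball (c i) eps.

(* +oo when E has no finite cover; otherwise the infimum of this nonempty set
   of naturals is its minimum. *)
Definition cover_number (R : realType) (d : nat) (E : set 'rV[R]_d) (eps : R) :
    \bar R :=
  ereal_inf [set (n%:R)%:E | n in [set n : nat | covered_by E eps n]].

Definition assouad_bound (R : realType) (d : nat) (A : set 'rV[R]_d) (s : R) :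
    Prop :=
  exists2 C : R, 0 < C & forall (x : 'rV[R]_d) (delta eps : R),
    A x -> 0 < eps -> eps < delta ->
    (cover_number (eball x delta `&` A) eps
      <= (C * (delta / eps) `^ s)%:E)%E.

Definition assouad_dim (R : realType) (d : nat) (A : set 'rV[R]_d) : \bar R :=
  ereal_inf [set s%:E | s in [set s : R | 0 <= s /\ assouad_bound A s]].

(* Main.v *)
From Pilot Require Import Defs.
From mathcomp Require Import all_boot all_order all_algebra.
From mathcomp Require Import all_classical all_reals all_analysis.
From mathcomp Require Import ring lra.
(* The name covered_by is also that of a notion of general topology; the one on
   covers by Euclidean balls is meant throughout. *)
Import Pilot.Defs.

(** Write [d] for the dimension of the ambient space.

    The upper bound holds for every set: a ball of radius [delta] is covered by
    a cubic grid of about [(delta / eps) ^ d] balls of radius [eps].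

    For the lower bound, the point is that from far enough away the translations
    [t_theta] become invisible, although they need not be bounded in [theta]:
    at a fixed relative resolution [delta / eps] only finitely many directions
    matter, and finitely many translations are bounded.  Concretely, fix [m] and
    consider the [m ^ d] integer vectors [k] of the cube [{1, ..., m} ^ d].  The
    half-line of direction [k / |k|] passes through [rho k + t] for every
    [rho >= 0], where [t] is its origin; so if [rho] is large compared with the
    [m ^ d] origins involved, [K] contains a slightly perturbed copy of the grid
    [rho {1, ..., m} ^ d] ([perturbed_grid]).  This copy lies in a ball of radius
    [delta = 2 d m rho], and a ball of radius [eps = rho / 4] contains at most
    one of its points.  An Assouad bound with exponent [s] thus gives
    [m ^ d <= C (8 d m) ^ s] for all [m >= 1] ([assouad_bound_grid]), which
    forces [d <= s] by letting [m] grow. *)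

Local Open Scope classical_set_scope.
Local Open Scope ring_scope.
Import Order.TTheory GRing.Theory Num.Theory.

Set Implicit Arguments.
Unset Strict Implicit.
Unset Printing Implicit Defensive.

(** * Euclidean norm and coordinates *)

Lemma coord_le_enorm (R : realType) (d : nat) (x : 'rV[R]_d) (i : 'I_d) :
  `|x ord0 i| <= enorm x.
Proof.
rewrite -sqrtr_sqr; apply: ler_wsqrtr.
by rewrite (bigD1 i) //= lerDl sumr_ge0 // => j _; exact: sqr_ge0.
Qed.

Lemma enorm_ge0 (R : realType) (d : nat) (x : 'rV[R]_d) : 0 <= enorm x.
Proof. exact: sqrtr_ge0. Qed.

(** The sharp constant is the square root of [d]; a factor depending on [d] only
    has no effect on dimensions. *)
Lemma enorm_le_coord (R : realType) (d : nat) (x : 'rV[R]_d) (b : R) :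
  0 <= b -> (forall i, `|x ord0 i| <= b) -> enorm x <= d%:R * b.
Proof.
move=> b0 xb; rewrite -[leRHS]ger0_norm ?mulr_ge0 // -sqrtr_sqr.
apply: ler_wsqrtr; apply: (@le_trans _ _ (\sum_(i < d) b ^+ 2)).
  by apply: ler_sum => i _; rewrite -real_normK ?num_real // lerXn2r ?nnegrE.
rewrite sumr_const card_ord exprMn -[leLHS]mulr_natl ler_wpM2r ?sqr_ge0 //.
by rewrite -natrX ler_nat; case: d {x xb} => // d; rewrite leq_pmulr.
Qed.

(** * Covers by a grid: the upper bound *)

Lemma covered_by_le (R : realType) (d : nat) (E F : set 'rV[R]_d) (eps : R)
    (n : nat) :
  E `<=` F -> covered_by F eps n -> covered_by E eps n.
Proof. by move=> EF [c Fc]; exists c; apply: subset_trans Fc. Qed.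

Lemma cover_number_le (R : realType) (d : nat) (E : set 'rV[R]_d) (eps : R)
    (n : nat) :
  covered_by E eps n -> (cover_number E eps <= n%:R%:E)%E.
Proof. by move=> En; apply: ereal_inf_lbound; exists n. Qed.

(** The centres form a grid of mesh [eps / (d + 1)], starting from the lowest
    corner of the cube circumscribed to the ball. *)
Lemma eball_covered_by (R : realType) (d : nat) (x : 'rV[R]_d) (delta eps : R) :
  0 < eps -> 0 <= delta ->
  covered_by (eball x delta) eps
    ((Num.truncn (2 * d.+1%:R * (delta / eps))).+1 ^ d)%N.
Proof.
move=> e0 d0; set N := (Num.truncn _).+1.
have card_grid : #|{ffun 'I_d -> 'I_N}| = (N ^ d)%N.
  by rewrite card_ffun !card_ord.
pose h := eps / d.+1%:R.
have h0 : 0 < h by rewrite divr_gt0.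
exists (fun j => \row_i (x ord0 i - delta
  + (enum_val (cast_ord (esym card_grid) j) i : nat)%:R * h)).
move=> y xy /=.
pose u i := (y ord0 i - x ord0 i + delta) / h.
have yx i : `|y ord0 i - x ord0 i| <= delta.
  by have := le_trans (coord_le_enorm _ i) xy; rewrite !mxE.
have u0 i : 0 <= u i.
  by rewrite divr_ge0 ?(ltW h0) //; have := yx i; rewrite ler_norml; lra.
have uN i : (Num.truncn (u i) < N)%N.
  rewrite ltnS; apply: le_truncn; rewrite /u /h invf_div.
  rewrite [leRHS](_ : _ = 2 * delta * (d.+1%:R / eps)); last by ring.
  rewrite ler_wpM2r ?divr_ge0 ?(ltW e0) //.
  by have := yx i; rewrite ler_norml; lra.
exists (cast_ord card_grid (enum_rank [ffun i => Ordinal (uN i)])) => //.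
rewrite /eball /=; apply: (@le_trans _ _ (d%:R * h)); last first.
  by rewrite /h mulrA ler_pdivrMr // mulrC ler_pM2l // ler_nat.
apply: enorm_le_coord; first exact: ltW.
move=> i; rewrite !mxE cast_ordK enum_rankK ffunE /=.
have -> : y ord0 i - (x ord0 i - delta + (Num.truncn (u i))%:R * h)
    = (u i - (Num.truncn (u i))%:R) * h.
  by rewrite mulrBl /u divfK ?gt_eqF //; ring.
have /andP[ul uu] := truncn_itv (u0 i).
rewrite normrM (gtr0_norm h0) ler_piMl ?(ltW h0) //.
by rewrite -natr1 in uu; rewrite ler_norml; lra.
Qed.

Lemma assouad_bound_ambient (R : realType) (d : nat) (A : set 'rV[R]_d) :
  assouad_bound A d%:R.
Proof.
exists ((2 * d.+1%:R + 1) ^+ d) => [|x delta eps _ e0 ed].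
  by rewrite exprn_gt0 // addr_gt0 ?mulr_gt0.
have d0 : 0 < delta by exact: lt_trans ed.
have q1 : 1 <= delta / eps by rewrite ler_pdivlMr // mul1r ltW.
apply: le_trans (cover_number_le _) _.
  exact: covered_by_le (@subIsetl _ _ _) (eball_covered_by _ e0 (ltW d0)).
have q0 : 0 <= delta / eps by exact: le_trans q1.
rewrite lee_fin powR_mulrn // -exprMn natrX lerXn2r ?nnegrE //.
  by rewrite mulr_ge0 // addr_ge0 ?mulr_ge0.
rewrite -[leLHS]natr1 [leRHS]mulrDl mul1r lerD //.
by have /andP[] := truncn_itv (mulr_ge0 (mulr_ge0 (ler0n R 2) (ler0n R d.+1)) q0).
Qed.

(** * Separated points: the lower bound *)

Lemma covered_by_separated (R : realType) (d : nat) (E : set 'rV[R]_d) (eps : R)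
    (n : nat) (T : finType) (p : T -> 'rV[R]_d) :
  (forall k, E (p k)) ->
  (forall k l, k != l -> exists i, 2 * eps < `|p k ord0 i - p l ord0 i|) ->
  covered_by E eps n -> (#|T| <= n)%N.
Proof.
move=> Ep sep [c Ec].
have /choice[f pf] : forall k, exists j, eball (c j) eps (p k).
  by move=> k; have [j _ pj] := Ec _ (Ep k); exists j.
rewrite -[n]card_ord; apply: (@leq_card _ _ f) => k l fkl.
apply/eqP/negPn/negP => /sep[i]; apply/negP; rewrite -leNgt.
have hk := le_trans (coord_le_enorm _ i) (pf k).
have hl := le_trans (coord_le_enorm _ i) (pf l).
move: hk hl; rewrite -fkl !mxE !ler_norml; lra.
Qed.

Lemma cover_number_separated (R : realType) (d : nat) (E : set 'rV[R]_d)
    (eps : R) (T : finType) (p : T -> 'rV[R]_d) :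
  (forall k, E (p k)) ->
  (forall k l, k != l -> exists i, 2 * eps < `|p k ord0 i - p l ord0 i|) ->
  (#|T|%:R%:E <= cover_number E eps)%E.
Proof.
move=> Ep sep; apply/ereal_infP => _ [n En <-].
by rewrite lee_fin ler_nat; exact: covered_by_separated En.
Qed.

(** A half-line of direction [v / |v|] contains a translate of the whole ray
    through [v], so directions need not be normalised. *)
Lemma half_line_through (R : realType) (d : nat) (K : set 'rV[R]_d)
    (v : 'rV[R]_d) :
  half_extended_besicovitch K -> 0 < enorm v ->
  exists t : 'rV[R]_d, forall rho, 0 <= rho -> K (rho *: v + t).
Proof.
move=> hK v0; have [|t tK] := hK ((enorm v)^-1 *: v).
  rewrite /unit_sphere /= {1}/enorm.
  under eq_bigr do rewrite mxE exprMn.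
  rewrite -mulr_sumr sqrtrM ?sqr_ge0 // sqrtr_sqr ger0_norm ?invr_ge0 ?enorm_ge0 //.
  by rewrite mulVf // gt_eqF.
exists t => rho r0; apply: tK; exists (rho * enorm v).
  by rewrite /= mulr_ge0 // ltW.
by rewrite scalerA mulfK // gt_eqF.
Qed.

(** The [m ^ d] origins are fixed before [rho] is chosen, so [rho] can be taken
    larger than all of them.  Coordinates of the integer vectors are shifted by
    one because the zero vector has no direction. *)
Lemma perturbed_grid (R : realType) (d m : nat) (K : set 'rV[R]_d) :
  half_extended_besicovitch K -> (0 < d)%N -> (0 < m)%N ->
  exists (rho : R) (p : {ffun 'I_d -> 'I_m} -> 'rV[R]_d),
    [/\ 0 < rho, forall k, K (p k),
        forall k l i, `|p k ord0 i - p l ord0 i| <= 2 * m%:R * rho &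
        forall k l, k != l ->
          exists i, rho / 2 < `|p k ord0 i - p l ord0 i|].
Proof.
move=> hK d0 m0.
pose v (k : {ffun 'I_d -> 'I_m}) : 'rV[R]_d := \row_i (k i).+1%:R.
have /choice[t tK] : forall k, exists u : 'rV[R]_d,
    forall rho, 0 <= rho -> K (rho *: v k + u).
  move=> k; apply: half_line_through => //.
  by apply: lt_le_trans (coord_le_enorm _ (Ordinal d0)); rewrite mxE normr_gt0.
pose M := \sum_k enorm (t k).
have M0 : 0 <= M by apply: sumr_ge0 => k _; exact: enorm_ge0.
have tM k i : `|t k ord0 i| <= M.
  apply: le_trans (coord_le_enorm _ _) _.
  by rewrite /M (bigD1 k) //= lerDl sumr_ge0 // => l _; exact: enorm_ge0.
(* The origins move two points by at most [2 M] relative to each other, which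
   stays below half the mesh of the grid. *)
pose rho := 4 * M + 1.
have rho0 : 0 < rho by rewrite /rho; lra.
exists rho, (fun k => rho *: v k + t k).
have diffE k l i : (rho *: v k + t k) ord0 i - (rho *: v l + t l) ord0 i
    = rho * ((k i)%:R - (l i)%:R) + (t k ord0 i - t l ord0 i).
  by rewrite !mxE -!natr1; ring.
have diffM k l i : `|t k ord0 i - t l ord0 i| <= 2 * M.
  by have := tM k i; have := tM l i; rewrite !ler_norml; lra.
split=> //.
- by move=> k; apply: tK; exact: ltW.
- move=> k l i; rewrite diffE; apply: le_trans (ler_normD _ _) _.
  have m1 : 1 <= m%:R :> R by rewrite ler1n.
  have klm : `|(k i)%:R - (l i)%:R| <= m%:R :> R.
    have := ltn_ord (k i); have := ltn_ord (l i).
    rewrite -!(ltr_nat R) => hl hk.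
    have := ler0n R (k i); have := ler0n R (l i).
    by rewrite ler_norml; lra.
  apply: (@le_trans _ _ (m%:R * rho + m%:R * rho)); last by lra.
  apply: lerD; first by rewrite normrM (gtr0_norm rho0) mulrC ler_wpM2r // ltW.
  apply: le_trans (diffM k l i) _; apply: (@le_trans _ _ rho).
    by rewrite /rho; lra.
  by rewrite ler_peMl // ltW.
- move=> k l kl.
  have [i kli] : exists i, k i != l i.
    apply/existsP; rewrite -negb_forall; apply: contra kl => /forallP h.
    by apply/eqP/ffunP => i; apply/eqP.
  exists i; rewrite diffE.
  have kl1 : 1 <= `|(k i)%:R - (l i)%:R| :> R.
    have : (k i : nat) != l i by [].
    rewrite neq_ltn => /orP[] h.
    + have : (k i).+1%:R <= (l i)%:R :> R by rewrite ler_nat.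
      by rewrite -natr1 distrC => h'; rewrite ler_normr; apply/orP; left; lra.
    + have : (l i).+1%:R <= (k i)%:R :> R by rewrite ler_nat.
      by rewrite -natr1 => h'; rewrite ler_normr; apply/orP; left; lra.
  have rkl : rho <= `|rho * ((k i)%:R - (l i)%:R)|.
    by rewrite normrM (gtr0_norm rho0) ler_peMr // ltW.
  have := diffM k l i; have := lerB_normD (rho * ((k i)%:R - (l i)%:R))
    (t k ord0 i - t l ord0 i).
  by rewrite /rho in rkl *; lra.
Qed.

(** Apply the bound at a point of the perturbed grid, with [delta] a bound on
    the diameter of the grid and [eps] a quarter of its mesh: the scale [rho], on which there
    is no control as [m] varies, cancels in [delta / eps]. *)
Lemma assouad_bound_grid (R : realType) (d : nat) (K : set 'rV[R]_d) (s : R) :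
  half_extended_besicovitch K -> (0 < d)%N -> assouad_bound K s ->
  exists2 C : R, 0 < C &
    forall m, (0 < m)%N -> m%:R ^+ d <= C * (8 * d%:R * m%:R) `^ s.
Proof.
move=> hK d0 [C C0 bC]; exists C => // m m0.
have [rho [p [rho0 pK diam sep]]] := perturbed_grid hK d0 m0.
pose x := p [ffun=> Ordinal m0].
pose delta := d%:R * (2 * m%:R * rho).
pose eps := rho / 4.
have e0 : 0 < eps by rewrite /eps; lra.
have dm1 : 1 <= d%:R * m%:R :> R by rewrite -natrM ler1n muln_gt0 d0.
have deltaE : delta = 8 * d%:R * m%:R * eps by rewrite /delta /eps; field.
have ed : eps < delta.
  rewrite deltaE -[ltLHS]mul1r ltr_pM2r //; rewrite -mulrA; lra.
have := bC x delta eps (pK _) e0 ed.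
rewrite deltaE mulfK ?gt_eqF // -deltaE => cov.
rewrite -lee_fin; apply: le_trans cov.
have -> : m%:R ^+ d = #|{ffun 'I_d -> 'I_m}|%:R :> R.
  by rewrite card_ffun !card_ord natrX.
apply: (@cover_number_separated _ _ _ _ _ p) => [k|k l kl].
- split=> //; rewrite /eball /=; apply: enorm_le_coord.
    by rewrite !mulr_ge0 // ltW.
  by move=> i; have := diam k [ffun=> Ordinal m0] i; rewrite !mxE.
- have [i hi] := sep _ _ kl; exists i; move: hi; rewrite /eps; lra.
Qed.

Lemma natr_powR_unbounded (R : realType) (a C : R) :
  0 < a -> exists2 m, (0 < m)%N & C < m%:R `^ a.
Proof.
move=> a0; exists (Num.truncn (`|C| `^ a^-1)).+1 => //.
apply: le_lt_trans (ler_norm C) _.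
rewrite [ltLHS](_ : _ = (`|C| `^ a^-1) `^ a); last first.
  by rewrite -powRrM mulVf ?lt0r_neq0 // powRr1.
by rewrite gt0_ltr_powR ?nnegrE ?powR_ge0 ?truncnS_gt.
Qed.

Lemma assouad_bound_ge_dim (R : realType) (d : nat) (K : set 'rV[R]_d) (s : R) :
  half_extended_besicovitch K -> 0 <= s -> assouad_bound K s -> d%:R <= s.
Proof.
move=> hK s0 bs; rewrite leNgt; apply/negP => sd.
have d0 : (0 < d)%N by rewrite -(ltr_nat R); exact: le_lt_trans sd.
have [C C0 hC] := assouad_bound_grid hK d0 bs.
have [|m m0] := @natr_powR_unbounded R (d%:R - s) (C * (8 * d%:R) `^ s).
  by rewrite subr_gt0.
have := hC m m0; rewrite powRM // mulrA.
have mneq0 : m%:R != 0 :> R by rewrite pnatr_eq0 -lt0n.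
have ms0 : 0 < m%:R `^ s :> R by rewrite powR_gt0 ?ltr0n.
have -> : m%:R ^+ d = m%:R `^ (d%:R - s) * m%:R `^ s :> R.
  rewrite -powRD ?subrK ?powR_mulrn //.
  by rewrite mneq0 implybT.
by rewrite ler_pM2r // leNgt => /negP.
Qed.

Theorem theorem7p1 (R : realType) (d : nat) (K : set 'rV[R]_d)
    (hK : half_extended_besicovitch K) :
  assouad_dim K = (d%:R)%:E.
Proof.
apply/eqP; rewrite eq_le; apply/andP; split.
- apply: ereal_inf_lbound; exists d%:R => //; split => //.
  exact: assouad_bound_ambient.
- apply/ereal_infP => _ [s [s0 bs] <-]; rewrite lee_fin.
  exact: assouad_bound_ge_dim bs.
Qed.
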